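(* Let $N_r\ge N_t\ge 2$, let $\mathbf{H}\in\mathbb{C}^{N_r\times N_t}$, let $E_s,N_0>0$, and fix $1\le\nu\le N_t-1$. Assume $\mathbf{x}\sim\mathcal{CN}(\mathbf{0},E_s\mathbf{I}_{N_t})$ with density $p(\mathbf{x})$, and let $\mathbf{y}=\mathbf{H}\mathbf{x}+\mathbf{z}$ with $\mathbf{z}\sim\mathcal{CN}(\mathbf{0},N_0\mathbf{I}_{N_r})$ independent of $\mathbf{x}$. For $\mathbf{F}\in\mathbb{C}^{N_r\times N_t}$ and a Hermitian positive semidefinite $\mathbf{G}\in\mathbb{C}^{N_t\times N_t}$, define $$p_{\mathrm m}(\mathbf{y}|\mathbf{x})=\exp\big(2\,\mathrm{Re}\{\mathbf{y}^\dagger\mathbf{F}\mathbf{x}\}-\mathbf{x}^\dagger\mathbf{G}\mathbf{x}+\tfrac{1}{E_s}\mathbf{x}^\dagger\mathbf{x}\big),\qquad p_{\mathrm m}(\mathbf{y})=\int p_{\mathrm m}(\mathbf{y}|\mathbf{x})p(\mathbf{x})\,d\mathbf{x},$$ and $$I_{\mathrm{LB}}(\mathbf{F},\mathbf{G})=\mathbb{E}_{\mathbf{Y},\mathbf{X}}[\log p_{\mathrm m}(\mathbf{y}|\mathbf{x})]-\mathbb{E}_{\mathbf{Y}}[\log p_{\mathrm m}(\mathbf{y})],$$ with expectations taken over the true joint distribution of $(\mathbf{x},\mathbf{y})$. Consider the maximization of $I_{\mathrm{LB}}$ over $\mathbf{F}$ and over $\mathbf{G}=\mathbf{J}^\dagger\mathbf{J}$,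 where $\mathbf{J}$ has a punctured structure of order $\nu$, i.e. $$\mathbf{J}=\begin{bmatrix}\mathbf{J}_1&\mathbf{0}\\ \mathbf{J}_2&\mathbf{J}_3\end{bmatrix}$$ with $\mathbf{J}_1\in\mathbb{C}^{\nu\times\nu}$ lower triangular, $\mathbf{J}_2\in\mathbb{C}^{(N_t-\nu)\times\nu}$ arbitrary, and $\mathbf{J}_3\in\mathbb{R}^{(N_t-\nu)\times(N_t-\nu)}$ real diagonal. Then the optimal $\mathbf{F}$ and $\mathbf{G}$ are $$\mathbf{F}^{\mathrm{opt}}=\mathbf{W}_{\mathrm{MMSE}}^\dagger\mathbf{G}^{\mathrm{opt}},\qquad \mathbf{G}^{\mathrm{opt}}=\mathbf{J}^{\mathrm{opt}\dagger}\mathbf{J}^{\mathrm{opt}},\qquad \mathbf{J}^{\mathrm{opt}}=\mathbf{L}_{\mathrm{ap}},$$ where $\mathbf{W}_{\mathrm{MMSE}}$ and $\mathbf{L}_{\mathrm{ap}}$ are defined in the context. Consequently, the value $N_t\log E_s+\log\det(\mathbf{L}_{\mathrm{ap}}^\dagger\mathbf{L}_{\mathrm{ap}})$, attained by the augmented WLD detector (the choice $\mathbf{F}=\mathbf{W}_{\mathrm{MMSE}}^\dagger\mathbf{L}_{\mathrm{ap}}^\dagger\mathbf{L}_{\mathrm{ap}}$, $\mathbf{G}=\mathbf{L}_{\mathrm{ap}}^\dagger\mathbf{L}_{\mathrm{ap}}$), is the optimal value of $I_{\mathrm{LB}}$ over this class.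
   Context: Let $\alpha=N_0/E_s$, and let $\mathbf{W}_{\mathrm{MMSE}}=(\mathbf{H}^\dagger\mathbf{H}+\alpha\mathbf{I}_{N_t})^{-1}\mathbf{H}^\dagger$ be the standard MMSE filter. Form the augmented matrix $$\mathbf{H}_{\mathrm a}=\begin{bmatrix}\tfrac{1}{\sqrt{N_0}}\mathbf{H}\\ \tfrac{1}{\sqrt{E_s}}\mathbf{I}_{N_t}\end{bmatrix}$$ and let $\mathbf{H}_{\mathrm a}=\mathbf{Q}_{\mathrm a}\mathbf{L}_{\mathrm a}$ be its thin QL decomposition: $\mathbf{Q}_{\mathrm a}$ has orthonormal columns and $\mathbf{L}_{\mathrm a}$ is $N_t\times N_t$ lower triangular with real positive diagonal entries. Partition $$\mathbf{L}_{\mathrm a}=\begin{bmatrix}\mathbf{P}_{\mathrm a}&\mathbf{0}\\ \mathbf{R}_{\mathrm a}&\mathbf{S}_{\mathrm a}\end{bmatrix},$$ with $\mathbf{P}_{\mathrm a}$ of size $\nu\times\nu$ and $\mathbf{S}_{\mathrm a}$ of size $(N_t-\nu)\times(N_t-\nu)$. Define $$\boldsymbol{\Sigma}_{\mathrm a}=\operatorname{diag}(\mathbf{S}_{\mathrm a}^{-1}\mathbf{S}_{\mathrm a}^{-\dagger})^{-1/2},\qquad \mathbf{W}_{\mathrm{ap}}=\begin{bmatrix}\mathbf{I}_\nu&\mathbf{0}\\ \mathbf{0}&\boldsymbol{\Sigma}_{\mathrm a}\mathbf{S}_{\mathrm a}^{-1}\end{bmatrix},\qquad \mathbf{L}_{\mathrm{ap}}=\mathbf{W}_{\mathrm{ap}}\mathbf{L}_{\mathrm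 a}.$$ Here $\operatorname{diag}(\mathbf{A})$ denotes the diagonal matrix having the same diagonal entries as $\mathbf{A}$, the superscript $\dagger$ denotes conjugate transpose, and $\log$ is the natural logarithm. *)

(* Defs.v *)
From HB Require Import structures.
From mathcomp Require Import all_boot all_order all_algebra complex.
From mathcomp Require Import all_classical all_reals all_analysis.
Set Implicit Arguments.
Unset Strict Implicit.
Unset Printing Implicit Defensive.
Import Order.TTheory GRing.Theory Num.Theory.
Local Open Scope ring_scope.

Section Defs.
Variable R : realType.
Local Notation C := (R[i]).

Definition ctr (m n : nat) (A : 'M[C]_(m, n)) : 'M[C]_(n, m) :=
  (map_mx (@conjc R) A)^T.

Definition sc (A : 'M[C]_1) : C := A 0 0.

Definition sqnorm (n : nat) (x : 'cV[C]_n) : R := complex.Re (sc (ctr x *m x)).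

Definition elog (t : \bar R) : \bar R :=
  match t with
  | EFin r => if 0 < r then (ln r)%:E else -oo%E
  | +oo%E => +oo%E
  | -oo%E => -oo%E
  end.

(* Iterated Lebesgue integral over the first k real coordinates of
   v : nat -> R (coordinates >= k are set to 0). This is Lebesgue
   integration on R^k (coordinatewise, Fubini/Tonelli). *)
Fixpoint iint (k : nat) (f : (nat -> R) -> \bar R) : \bar R :=
  match k with
  | 0 => f (fun _ => 0)
  | k'.+1 => (\int[@lebesgue_measure R]_t
                iint k' (fun v => f (fun i => if i == k' then t else v i)))%E
  end.

(* the complex vector in C^n whose j-th entry has real part v (off + 2j)
   and imaginary part v (off + 2j + 1); Lebesgue measure on C^n is the
   Lebesgue measure on R^(2n) through this identification *)
Definition cvecAt (off n : nat) (v : nat -> R) : 'cV[C]_n :=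
  \col_(j < n) (v (off + 2 * j)%N +i* v (off + 2 * j + 1)%N)%C.

Definition cn_pdf (n : nat) (s : R) (x : 'cV[C]_n) : R :=
  expR (- sqnorm x / s) / (pi * s) ^+ n.

Section Model.
Variables (Nr Nt : nat) (H : 'M[C]_(Nr, Nt)) (Es N0 : R).

Definition Exy (g : 'cV[C]_Nt -> 'cV[C]_Nr -> \bar R) : \bar R :=
  iint (2 * Nt + 2 * Nr)
    (fun v => let x := cvecAt 0 Nt v in let z := cvecAt (2 * Nt) Nr v in
       let y := H *m x + z in
       let w := cn_pdf Es x * cn_pdf N0 z in
       (g x y * w%:E)%E).

Definition pm_cond (F : 'M[C]_(Nr, Nt)) (G : 'M[C]_Nt)
  (y : 'cV[C]_Nr) (x : 'cV[C]_Nt) : R :=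
  expR (2 * complex.Re (sc (ctr y *m F *m x)) - complex.Re (sc (ctr x *m G *m x))
        + sqnorm x / Es).

Definition pm_marg (F : 'M[C]_(Nr, Nt)) (G : 'M[C]_Nt) (y : 'cV[C]_Nr)
  : \bar R :=
  iint (2 * Nt) (fun v => let x := cvecAt 0 Nt v in
                   (pm_cond F G y x * cn_pdf Es x)%:E).

Definition I_LB (F : 'M[C]_(Nr, Nt)) (G : 'M[C]_Nt) : \bar R :=
  (Exy (fun x y => (ln (pm_cond F G y x))%:E)
   - Exy (fun _ y => elog (pm_marg F G y)))%E.

End Model.

Definition punctured (nu k : nat) (J : 'M[C]_(nu + k)) : Prop :=
  [/\ forall i j : 'I_nu, (i < j)%N -> ulsubmx J i j = 0,
      ursubmx J = 0,
      forall i j : 'I_k, i != j -> drsubmx J i j = 0 &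
      forall i : 'I_k, complex.Im (drsubmx J i i) = 0].

Definition lower_tri_posdiag (n : nat) (L : 'M[C]_n) : Prop :=
  (forall i j : 'I_n, (i < j)%N -> L i j = 0) /\ (forall i : 'I_n, 0 < L i i).

Definition W_MMSE (Nr Nt : nat) (H : 'M[C]_(Nr, Nt)) (Es N0 : R)
  : 'M[C]_(Nt, Nr) :=
  invmx (ctr H *m H + ((N0 / Es)%:C)%C%:M) *m ctr H.

Definition H_aug (Nr Nt : nat) (H : 'M[C]_(Nr, Nt)) (Es N0 : R)
  : 'M[C]_(Nr + Nt, Nt) :=
  col_mx (((Num.sqrt N0)^-1)%:C%C *: H) (((Num.sqrt Es)^-1)%:C%C *: 1%:M).

(* Sigma_a = diag(S^{-1} S^{-dag})^{-1/2}; the diagonal entries are real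
   positive, so the power -1/2 is taken on their (real) value *)
Definition Sigma_a (k : nat) (S : 'M[C]_k) : 'M[C]_k :=
  diag_mx (\row_i (((Num.sqrt (complex.Re ((invmx S *m ctr (invmx S)) i i)))^-1)%:C)%C).

Definition L_ap (nu k : nat) (La : 'M[C]_(nu + k)) : 'M[C]_(nu + k) :=
  block_mx 1%:M 0 0 (Sigma_a (drsubmx La) *m invmx (drsubmx La)) *m La.

(* log det of a Hermitian positive definite matrix (real determinant) *)
Definition logdet (n : nat) (M : 'M[C]_n) : R := ln (complex.Re (\det M)).

End Defs.

(* Main.v *)
(* Completing the square in the complex Gaussian integral gives, for [G = J^* J]
   invertible,
     [ln p_m(y) = - Nt ln Es - ln det G + y^* F G^-1 F^* y],
   whereas [p_m = +oo], hence [I_LB = -oo], for singular [G].  With Gaussian second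
   moments [I_LB] becomes an explicit function of [(F, G)]; it is a concave quadratic
   in [F], maximal exactly at [F = W^* G] with [W] the MMSE filter.  Since the MMSE
   error covariance is [(La^* La)^-1], what remains to be maximized is
     [ln det (J^* J) - |J La^-1|^2]
   (Frobenius norm).  For a punctured [J], the lower right block of [J La^-1] is a
   diagonal matrix times [S^-1] and has the norm of a diagonal matrix, so the bound
   [ln det (T^* T) <= |T|^2 - n], a consequence of [ln t <= t - 1], applies to a block
   diagonal [T] with [det J = det T * det L_ap]; it is an equality for [J = L_ap]. *)
Require Import Defs.
From HB Require Import structures.
From mathcomp Require Import all_boot all_order all_algebra complex zify ring lra.
From mathcomp Require Import all_classical all_reals all_analysis measurable_realfun.
Import Order.TTheory GRing.Theory Num.Theory.
Import numFieldNormedType.Exports.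
Local Open Scope classical_set_scope.
Local Open Scope ring_scope.
Set Implicit Arguments.
Unset Strict Implicit.
Unset Printing Implicit Defensive.

(** * Gaussian integrals over the real line *)

Section Gauss1D.
Variable R : realType.
Implicit Types a c p s t : R.
Local Notation mu := (@lebesgue_measure R).

(** Completing the square exhibits the integrand as a constant times the normal density of mean
    [p / a] and variance [1 / (2 * a)]. *)
Lemma integral_expR_quad a c p : 0 < a ->
  (\int[mu]_t (expR (c + 2 * p * t - a * t ^+ 2))%:E)%E
  = (Num.sqrt (pi / a) * expR (c + p ^+ 2 / a))%:E.
Proof.
move=> a0; pose sg := Num.sqrt ((2 * a)^-1).
have sg2 : sg ^+ 2 = (2 * a)^-1 by rewrite sqr_sqrtr // invr_ge0 mulr_ge0 ?ltW.
have sg0 : sg != 0 by rewrite gt_eqF // sqrtr_gt0 invr_gt0 mulr_gt0.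
pose K := Num.sqrt (pi / a) * expR (c + p ^+ 2 / a).
have E t : expR (c + 2 * p * t - a * t ^+ 2) = K * normal_pdf (p / a) sg t.
  rewrite normal_pdfE // /normal_peak /normal_fun /K.
  have -> : sg ^+ 2 * pi *+ 2 = pi / a by rewrite sg2 -mulr_natr; field; rewrite gt_eqF.
  rewrite mulrACA divff ?mul1r; last first.
    by rewrite gt_eqF // sqrtr_gt0 divr_gt0 ?pi_gt0.
  rewrite -expRD; congr expR.
  rewrite sg2 -mulr_natr; field.
  by rewrite gt_eqF.
under eq_integral do rewrite E EFinM.
rewrite integralZl //=; first by rewrite integral_normal_pdf mule1.
exact: integrable_normal_pdf.
Qed.

(** On the half-line where [p * t] is nonnegative, the integrand is at least [expR c], and that
    half-line has infinite measure. *)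
Lemma integral_expR_affine c p :
  (\int[mu]_t (expR (c + 2 * p * t))%:E)%E = +oo%E.
Proof.
have infT (D : set R) : measurable D -> mu D = +oo%E ->
    (forall t, D t -> 0 <= p * t) ->
    (\int[mu]_t (expR (c + 2 * p * t))%:E)%E = +oo%E.
  move=> mD muD pos; apply/eqP; rewrite -leye_eq.
  have <- : (\int[mu]_(t in D) (expR c)%:E = +oo)%E.
    transitivity ((expR c)%:E * mu D)%E; first exact: integral_cst.
    by rewrite muD gt0_muley // lte_fin expR_gt0.
  have mf : measurable_fun setT (fun t : R => expR (c + 2 * p * t)).
    apply: measurableT_comp => //.
    by apply: measurable_funD => //; apply: measurable_funM.
  apply: (@le_trans _ _ (\int[mu]_(t in D) (expR (c + 2 * p * t))%:E)%E).
    apply: ge0_le_integral.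
    - exact: mD.
    - by move=> t _; rewrite lee_fin expR_ge0.
    - exact: measurable_cst.
    - by apply: measurable_funTS; apply/measurable_EFinP.
    - move=> t Dt; rewrite lee_fin ler_expR lerDl -mulrA mulr_ge0 //.
      exact: pos.
  apply: ge0_subset_integral.
  - exact: mD.
  - exact: measurableT.
  - by apply/measurable_EFinP.
  - by move=> t _; rewrite lee_fin expR_ge0.
  - exact: subsetT.
have [p0|p0] := leP 0 p.
- apply: (infT `[0, +oo[%classic) => //.
    by rewrite lebesgue_measure_itv /= ltry.
  by move=> t /=; rewrite in_itv /= andbT => t0; rewrite mulr_ge0.
- apply: (infT `]-oo, 0]%classic) => //.
    by rewrite lebesgue_measure_itv /= ltNyr.
  by move=> t /=; rewrite in_itv /= => t0; rewrite nmulr_rge0.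
Qed.

(** Dominated convergence over growing symmetric intervals, each integral being evaluated by the
    fundamental theorem of calculus. *)
Lemma integral_derive_eq0 (f F : R -> R) : continuous f ->
  mu.-integrable setT (EFin \o f) -> (forall t, is_derive t 1 F (f t)) ->
  (fun n : nat => F n%:R - F (- n%:R)) @ \oo --> (0 : R) ->
  (\int[mu]_t (f t)%:E = 0)%E.
Proof.
move=> cf If dF F0.
have mf : measurable_fun setT f by apply: continuous_measurable_fun.
(* Using [n.+1] keeps the interval nondegenerate, as the fundamental theorem requires. *)
pose D n := [set` `[(- n.+1%:R : R), n.+1%:R]].
pose g := fun n => (EFin \o f) \_ (D n).
have mg n : measurable_fun setT (g n).
  apply: (measurable_restrictT (EFin \o f) (measurable_itv _)).1.
  by apply: measurable_funTS; apply/measurable_EFinP.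
have cg t : g ^~ t @ \oo --> (EFin \o f) t.
  apply: cvg_near_cst; near=> m.
  rewrite /g patchE ifT // inE /D /= in_itv /= -ler_norml.
  near: m; exists (Num.truncn `|t|) => // m /= tm.
  by rewrite (le_trans (ltW (truncnS_gt _))) // ler_nat.
have mfE : measurable_fun setT (EFin \o f) by apply/measurable_EFinP.
have gf : {ae mu, forall t, setT t -> g ^~ t @ \oo --> (EFin \o f) t}.
  by apply: aeW => t _.
have gle : {ae mu, forall t n, setT t -> (`|g n t| <= `|(f t)%:E|)%E}.
  by apply: aeW => t m _; rewrite /g patchE; case: ifP => // _; rewrite abse0.
have [_ _ L] := @dominated_convergence _ _ R mu setT measurableT g _ _ mg mfE gf
  (integrable_abse If) gle.
have Eg n : (\int[mu]_t g n t = (F n.+1%:R - F (- n.+1%:R))%:E)%E.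
  rewrite /g -integral_mkcond /D EFinB.
  apply: continuous_FTC2.
  - by rewrite gtrN // ltr0n.
  - exact: continuous_subspaceT.
  - have cF x : {for x, continuous F}.
      by apply: differentiable_continuous; apply/derivable1_diffP; have [] := dF x.
    split; first by move=> x _; have [] := dF x.
    + by apply: cvg_at_right_filter; exact: cF.
    + by apply: cvg_at_left_filter; exact: cF.
  - by move=> x _; rewrite derive1E; have [_ ->] := dF x.
rewrite (funext Eg) in L.
have L0 : (fun n : nat => (F n.+1%:R - F (- n.+1%:R))%:E) @ \oo --> (0%:E : \bar R).
  apply: cvg_EFin; first by apply: nearW.
  have := F0; rewrite -(cvg_shiftS (fun n : nat => F n%:R - F (- n%:R))); exact.
by rewrite -(cvg_lim (@ereal_hausdorff R) L) (cvg_lim (@ereal_hausdorff R) L0).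
Unshelve. all: by end_near.
Qed.

(** * Moments of order at most two of a real Gaussian *)

Lemma integrable_expR_sq s : 0 < s ->
  mu.-integrable setT (EFin \o (fun t : R => expR (- t ^+ 2 / s))).
Proof.
move=> s0; apply/integrableP; split.
  apply/measurable_EFinP; apply: measurableT_comp => //.
  by apply: measurable_funM => //; apply: measurableT_comp.
under eq_integral => t _.
  rewrite /= ger0_norm ?expR_ge0 //.
  rewrite (_ : - t ^+ 2 / s = 0 + 2 * 0 * t - s^-1 * t ^+ 2); last by ring.
over.
by rewrite integral_expR_quad ?invr_gt0 // ltry.
Qed.

(** Half of the exponent absorbs the square: [u <= expR u] at [u = t ^+ 2 / (2 * s)]. *)
Lemma expR_sq_moment2_le s t : 0 < s ->
  t ^+ 2 * expR (- t ^+ 2 / s) <= 2 * s * expR (- t ^+ 2 / (2 * s)).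
Proof.
move=> s0; have -> : - t ^+ 2 / s = - t ^+ 2 / (2 * s) + - t ^+ 2 / (2 * s).
  by field; rewrite gt_eqF.
rewrite expRD mulrA ler_pM2r ?expR_gt0 //.
have := expR_ge1Dx (t ^+ 2 / (2 * s)) => h.
rewrite mulNr expRN ler_pdivrMr ?expR_gt0 //.
apply: (@le_trans _ _ (2 * s * (t ^+ 2 / (2 * s)))).
  by rewrite mulrCA divff ?mulr1 // gt_eqF // mulr_gt0.
rewrite ler_pM2l ?mulr_gt0 //.
lra.
Qed.

Lemma integrable_sq_expR_sq s : 0 < s ->
  mu.-integrable setT (EFin \o (fun t : R => t ^+ 2 * expR (- t ^+ 2 / s))).
Proof.
move=> s0.
have s20 : 0 < 2 * s by rewrite mulr_gt0.
have := integrableZl measurableT (2 * s) (integrable_expR_sq s20).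
apply: le_integrable => //.
  apply/measurable_EFinP; apply: measurable_funM => //.
  apply: measurableT_comp => //.
  by apply: measurable_funM => //; apply: measurableT_comp.
move=> t _ /=; rewrite lee_fin (ger0_norm (mulr_ge0 (sqr_ge0 _) (expR_ge0 _))).
rewrite (ger0_norm (mulr_ge0 (ltW s20) (expR_ge0 _))).
exact: expR_sq_moment2_le.
Qed.

(** Domination by [1 + t ^+ 2], which bounds [|t|] because the squares of [t - 1] and [t + 1] are
    nonnegative. *)
Lemma integrable_id_expR_sq s : 0 < s ->
  mu.-integrable setT (EFin \o (fun t : R => t * expR (- t ^+ 2 / s))).
Proof.
move=> s0.
have := integrableD measurableT (integrable_expR_sq s0) (integrable_sq_expR_sq s0).
apply: le_integrable => //.
  apply/measurable_EFinP; apply: measurable_funM => //.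
  apply: measurableT_comp => //.
  by apply: measurable_funM => //; apply: measurableT_comp.
move=> t _ /=; rewrite lee_fin -[X in _ <= `|X + _|]mul1r -mulrDl !normrM.
rewrite ler_wpM2r // [leRHS]ger0_norm ?addr_ge0 ?sqr_ge0 // ler_norml.
have := sqr_ge0 (t - 1); have := sqr_ge0 (t + 1).
rewrite !expr2 => h1 h2; apply/andP; split; nra.
Qed.

Lemma continuous_expR_sq s : continuous (fun t : R => expR (- t ^+ 2 / s)).
Proof.
move=> t; apply: (continuous_comp (f := fun t : R => - t ^+ 2 / s)).
  2: exact: continuous_expR.
apply: cvgM; last exact: cvg_cst.
by apply: cvgN; exact: sqr_continuous.
Qed.

Lemma is_derive_expR_sq s t :
  is_derive t 1 (fun t : R => expR (- t ^+ 2 / s)) (- 2 * t / s * expR (- t ^+ 2 / s)).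
Proof.
apply: is_derive_eq.
by rewrite /GRing.scale /=; ring.
Qed.

(** The antiderivative is even, so the boundary terms cancel exactly. *)
Lemma integral_id_expR_sq s : 0 < s ->
  (\int[mu]_t (t * expR (- t ^+ 2 / s))%:E = 0)%E.
Proof.
move=> s0.
apply: (integral_derive_eq0 (F := fun t => - (s / 2) * expR (- t ^+ 2 / s))).
- move=> t; apply: cvgM; first exact: cvg_id.
  exact: continuous_expR_sq.
- exact: integrable_id_expR_sq.
- move=> t.
  have := is_derive_expR_sq s t => h.
  apply: is_derive_eq.
  rewrite /GRing.scale /=; field.
  by rewrite gt_eqF.
- under eq_fun do rewrite sqrrN subrr.
  exact: cvg_cst.
Qed.

(** Centring the square at the variance [s / 2] gives the integrand an elementary antiderivative
    that vanishes at infinity. *)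
Lemma integral_sq_expR_sq s : 0 < s ->
  (\int[mu]_t ((t ^+ 2 - s / 2) * expR (- t ^+ 2 / s))%:E = 0)%E.
Proof.
move=> s0.
apply: (integral_derive_eq0 (F := fun t => - (s / 2) * (t * expR (- t ^+ 2 / s)))).
- move=> t; apply: cvgM; last exact: continuous_expR_sq.
  by apply: cvgB; [exact: sqr_continuous|exact: cvg_cst].
- have := integrableB measurableT (integrable_sq_expR_sq s0)
    (integrableZl measurableT (s / 2) (integrable_expR_sq s0)).
  by apply: eq_integrable => // t _ /=; rewrite mulrBl.
- move=> t.
  have := is_derive_expR_sq s t => h.
  apply: is_derive_eq.
  rewrite /GRing.scale /=; field.
  by rewrite gt_eqF.
- have E n : - (s / 2) * (n%:R * expR (- n%:R ^+ 2 / s))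
      - (- (s / 2) * (- n%:R * expR (- (- n%:R) ^+ 2 / s)))
      = - s * (n%:R * expR (- n%:R ^+ 2 / s)) by rewrite sqrrN; field.
  under eq_fun do rewrite E.
  suff L : (fun n : nat => n%:R * expR (- n%:R ^+ 2 / s)) @ \oo --> (0 : R).
    by have := cvgM (cvg_cst (- s)) L; rewrite mulr0; exact.
  (* The bound [2 * s / (n + 1)] comes from [n * (n + 1) <= 2 * n ^+ 2] and
     [n ^+ 2 / s <= expR (n ^+ 2 / s)]. *)
  apply: (@squeeze_cvgr _ _ _ _ (fun=> 0) (fun n => 2 * s * harmonic n)).
  + apply: nearW => n; rewrite mulr_ge0 ?expR_ge0 //=.
    rewrite /harmonic /= ler_pdivlMr // mulNr expRN.
    rewrite mulrAC ler_pdivrMr ?expR_gt0 //.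
    apply: (@le_trans _ _ (2 * n%:R ^+ 2)).
      rewrite -natrM -natrX -natrM ler_nat; case: n => // n.
      by rewrite -mulnn; lia.
    rewrite -mulrA ler_pM2l //.
    have := expR_ge1Dx (n%:R ^+ 2 / s).
    rewrite -(ler_pM2l s0) mulrDr mulrCA divff ?gt_eqF // mulr1.
    by apply: le_trans; rewrite ?mulr1 lerDr ltW.
  + exact: cvg_cst.
  + by have := cvgM (cvg_cst (2 * s)) (@cvg_harmonic R); rewrite mulr0; exact.
Qed.

Lemma integral_quad_expR_sq a b c s : 0 < s ->
  (\int[mu]_t ((a + b * t + c * t ^+ 2) * expR (- t ^+ 2 / s))%:E
   = ((a + c * (s / 2)) * Num.sqrt (pi * s))%:E)%E.
Proof.
move=> s0.
have I0 := integrableZl measurableT (a + c * (s / 2)) (integrable_expR_sq s0).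
have I1 := integrableZl measurableT b (integrable_id_expR_sq s0).
have I2' : mu.-integrable setT
    (EFin \o (fun t : R => (t ^+ 2 - s / 2) * expR (- t ^+ 2 / s))).
  have := integrableB measurableT (integrable_sq_expR_sq s0)
    (integrableZl measurableT (s / 2) (integrable_expR_sq s0)).
  by apply: eq_integrable => // t _ /=; rewrite mulrBl.
have I2 := integrableZl measurableT c I2'.
(* Writing [t ^+ 2] as [s / 2 + (t ^+ 2 - s / 2)] leaves a single term with nonzero integral. *)
have E t : ((a + b * t + c * t ^+ 2) * expR (- t ^+ 2 / s))%:E
  = (((a + c * (s / 2))%:E * (expR (- t ^+ 2 / s))%:E
    + b%:E * (t * expR (- t ^+ 2 / s))%:E)
    + c%:E * ((t ^+ 2 - s / 2) * expR (- t ^+ 2 / s))%:E)%E.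
  by rewrite -!EFinM -!EFinD; congr EFin; ring.
under eq_integral do rewrite E.
rewrite integralD //=; last exact: (integrableD _ I0 I1).
rewrite integralD //=.
rewrite (integralZl _ (integrable_expR_sq s0)) //.
rewrite (integralZl _ (integrable_id_expR_sq s0)) //.
rewrite (integralZl _ I2') //.
rewrite integral_id_expR_sq // integral_sq_expR_sq // !mule0 !adde0 EFinM.
congr (_ * _)%E.
transitivity (\int[mu]_t (expR (0 + 2 * 0 * t - s^-1 * t ^+ 2))%:E)%E.
  by apply: eq_integral => t _; congr (expR _)%:E; ring.
by rewrite integral_expR_quad ?invr_gt0 // invrK expr0n !mul0r addr0 expR0 mulr1.
Qed.

End Gauss1D.

(** * Conjugate transpose and Hermitian product *)

Section Hermitian.
Variable R : realType.
Local Notation C := R[i].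

Lemma ReD (x y : C) : complex.Re (x + y) = complex.Re x + complex.Re y.
Proof. by case: x y => [? ?] []. Qed.

Lemma ReN (x : C) : complex.Re (- x) = - complex.Re x.
Proof. by case: x. Qed.

Lemma ReB (x y : C) : complex.Re (x - y) = complex.Re x - complex.Re y.
Proof. by rewrite ReD ReN. Qed.

Lemma Re_sum (I : Type) (r : seq I) (P : pred I) (F : I -> C) :
  complex.Re (\sum_(i <- r | P i) F i) = \sum_(i <- r | P i) complex.Re (F i).
Proof. by elim/big_rec2: _ => // i y1 y2 _ <-; rewrite ReD. Qed.

Lemma Re_conjc (x : C) : complex.Re x^*%C = complex.Re x.
Proof. by case: x. Qed.

Lemma ReZ (a : R) (x : C) : complex.Re (a%:C%C * x) = a * complex.Re x.
Proof. by case: x => x y /=; rewrite mul0r subr0. Qed.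

Lemma ctrD m n (A B : 'M[C]_(m, n)) : ctr (A + B) = ctr A + ctr B.
Proof. by rewrite /ctr map_mxD linearD. Qed.

Lemma ctrN m n (A : 'M[C]_(m, n)) : ctr (- A) = - ctr A.
Proof. by rewrite /ctr map_mxN linearN. Qed.

Lemma ctrB m n (A B : 'M[C]_(m, n)) : ctr (A - B) = ctr A - ctr B.
Proof. by rewrite ctrD ctrN. Qed.

Lemma ctrZ m n a (A : 'M[C]_(m, n)) : ctr (a *: A) = a^*%C *: ctr A.
Proof. by rewrite /ctr map_mxZ linearZ. Qed.

Lemma ctrM m n p (A : 'M[C]_(m, n)) (B : 'M[C]_(n, p)) :
  ctr (A *m B) = ctr B *m ctr A.
Proof. by rewrite /ctr map_mxM trmx_mul. Qed.

Lemma ctrK m n (A : 'M[C]_(m, n)) : ctr (ctr A) = A.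
Proof. by apply/matrixP => i j; rewrite !mxE conjcK. Qed.

Lemma ctr0 m n : ctr (0 : 'M[C]_(m, n)) = 0.
Proof. by rewrite /ctr map_mx0 trmx0. Qed.

Lemma ctr_scalar n (a : C) : ctr (a%:M : 'M[C]_n) = (a^*%C)%:M.
Proof. by rewrite /ctr map_scalar_mx tr_scalar_mx. Qed.

Lemma ctr1 n : ctr (1%:M : 'M[C]_n) = 1%:M.
Proof. by rewrite ctr_scalar conjc1. Qed.

Lemma ctr_row_mx m n p (A : 'M[C]_(m, n)) (B : 'M[C]_(m, p)) :
  ctr (row_mx A B) = col_mx (ctr A) (ctr B).
Proof. by rewrite /ctr map_row_mx tr_row_mx. Qed.

Lemma ctr_col_mx m n p (A : 'M[C]_(m, n)) (B : 'M[C]_(p, n)) :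
  ctr (col_mx A B) = row_mx (ctr A) (ctr B).
Proof. by rewrite /ctr map_col_mx tr_col_mx. Qed.

Lemma det_ctr n (A : 'M[C]_n) : \det (ctr A) = (\det A)^*%C.
Proof. by rewrite /ctr det_tr det_map_mx. Qed.

Lemma mxtrace_ctr n (A : 'M[C]_n) : \tr (ctr A) = (\tr A)^*%C.
Proof. by rewrite /ctr mxtrace_tr trace_map_mx. Qed.

Lemma ctr_inv n (A : 'M[C]_n) : ctr (invmx A) = invmx (ctr A).
Proof. by rewrite /ctr map_invmx trmx_inv. Qed.

Lemma ctr_unit n (A : 'M[C]_n) : (ctr A \in unitmx) = (A \in unitmx).
Proof. by rewrite /ctr unitmx_tr map_unitmx. Qed.

Lemma det_gram_ge0 n (A : 'M[C]_n) : 0 <= \det (ctr A *m A).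
Proof. by rewrite det_mulmx det_ctr mulrC mulcJ_ge0. Qed.

Definition ip n (x y : 'cV[C]_n) : C := sc (ctr x *m y).

Lemma ipDl n (x y z : 'cV[C]_n) : ip (x + y) z = ip x z + ip y z.
Proof. by rewrite /ip ctrD mulmxDl /sc mxE. Qed.

Lemma ipDr n (x y z : 'cV[C]_n) : ip x (y + z) = ip x y + ip x z.
Proof. by rewrite /ip mulmxDr /sc mxE. Qed.

Lemma ipNl n (x z : 'cV[C]_n) : ip (- x) z = - ip x z.
Proof. by rewrite /ip ctrN mulNmx /sc mxE. Qed.

Lemma ipNr n (x z : 'cV[C]_n) : ip x (- z) = - ip x z.
Proof. by rewrite /ip mulmxN /sc mxE. Qed.

Lemma ipZl n a (x z : 'cV[C]_n) : ip (a *: x) z = a^*%C * ip x z.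
Proof. by rewrite /ip ctrZ -scalemxAl /sc mxE. Qed.

Lemma ipZr n a (x z : 'cV[C]_n) : ip x (a *: z) = a * ip x z.
Proof. by rewrite /ip -scalemxAr /sc mxE. Qed.

Lemma ip_mulr m n (A : 'M[C]_(m, n)) x y : ip x (A *m y) = ip (ctr A *m x) y.
Proof. by rewrite /ip ctrM ctrK mulmxA. Qed.

Lemma ip_conj n (x y : 'cV[C]_n) : ip y x = (ip x y)^*%C.
Proof. by rewrite /ip -[ctr y *m x]ctrK ctrM ctrK /sc [LHS]mxE mxE. Qed.

Lemma ip_col m n (x1 y1 : 'cV[C]_m) (x2 y2 : 'cV[C]_n) :
  ip (col_mx x1 x2) (col_mx y1 y2) = ip x1 y1 + ip x2 y2.
Proof. by rewrite /ip ctr_col_mx mul_row_col /sc mxE. Qed.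

Lemma ip_scalar (a b : C) : ip a%:M b%:M = a^*%C * b.
Proof. by rewrite /ip ctr_scalar -scalar_mxM /sc mxE eqxx. Qed.

Lemma sqnormE n (x : 'cV[C]_n) :
  sqnorm x = \sum_i (complex.Re (x i 0) ^+ 2 + complex.Im (x i 0) ^+ 2).
Proof.
rewrite /sqnorm /sc mxE Re_sum; apply: eq_bigr => i _.
by rewrite !mxE; case: (x i 0) => a b /=; ring.
Qed.

Lemma sqnorm_ge0 n (x : 'cV[C]_n) : 0 <= sqnorm x.
Proof. by rewrite sqnormE sumr_ge0 // => i _; rewrite addr_ge0 ?sqr_ge0. Qed.

Lemma sqnorm_eq0 n (x : 'cV[C]_n) : sqnorm x = 0 -> x = 0.
Proof.
rewrite sqnormE => /eqP; rewrite psumr_eq0; last first.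
  by move=> i _; rewrite addr_ge0 ?sqr_ge0.
move=> /allP h; apply/matrixP => i j; rewrite ord1 mxE.
have := h i (mem_index_enum i); rewrite paddr_eq0 ?sqr_ge0 // !sqrf_eq0.
by case: (x i 0) => a b /= /andP[/eqP-> /eqP->].
Qed.

Lemma ip_sqnorm n (x : 'cV[C]_n) : ip x x = (sqnorm x)%:C%C.
Proof.
have := ip_conj x x; rewrite /sqnorm -/(ip x x).
case: (ip x x) => a b [] /= h; apply/eqP; rewrite eq_complex /= eqxx /=.
by apply/eqP; lra.
Qed.

Lemma sqnormDZ n (z : C) (a w : 'cV[C]_n) :
  sqnorm (z *: a + w) =
  sqnorm a * (complex.Re z ^+ 2 + complex.Im z ^+ 2)
  + 2 * complex.Re (z^*%C * ip a w) + sqnorm w.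
Proof.
rewrite {1}/sqnorm -/(ip _ _) ipDl !ipDr !ipZl !ipZr !ip_sqnorm.
rewrite (ip_conj a w); case: z (ip a w) => [z1 z2] [i1 i2] /=.
by rewrite /=; ring.
Qed.

End Hermitian.

(** * Gaussian integrals over complex vectors *)

Section ComplexIntegral.
Variable R : realType.
Local Notation C := R[i].
Local Notation mu := (@lebesgue_measure R).

Lemma iint_pinfty k : iint k (fun _ : nat -> R => +oo%E) = +oo%E.
Proof.
elim: k => //= k ->; transitivity (+oo * mu setT)%E; first exact: integral_cst.
by rewrite -set_itvNyy lebesgue_measure_itv /= mulyy.
Qed.

Definition scons (t : R) (v : nat -> R) (i : nat) : R :=
  if i is j.+1 then v j else t.

(** [iint] already integrates coordinate 0 innermost; the other coordinates are merely renumbered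
    and the order of integration is kept. *)
Lemma iint_recl k (f : (nat -> R) -> \bar R) :
  iint k.+1 f = iint k (fun v => \int[mu]_t f (scons t v))%E.
Proof.
elim: k f => [|k IH] f.
  rewrite /=; apply: eq_integral => t _; congr f.
  by apply/funext => -[].
transitivity (\int[mu]_t iint k.+1
    (fun v => f (fun i => if i == k.+1 then t else v i)))%E; first by [].
rewrite [RHS]/=; apply: eq_integral => t _.
rewrite IH; congr iint; apply/funext => v.
apply: eq_integral => u _; congr f.
by apply/funext => -[].
Qed.

Definition cint n (f : 'cV[C]_n -> \bar R) : \bar R :=
  iint (2 * n) (fun v => f (cvecAt 0 n v)).

Lemma cint_recl n (f : 'cV[C]_(1 + n) -> \bar R) :
  cint f = cint (fun x : 'cV[C]_n =>
    \int[mu]_t1 \int[mu]_t0 f (col_mx (t0 +i* t1)%C%:M x))%E.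
Proof.
transitivity (iint (2 * n).+2 (fun v => f (cvecAt 0 (1 + n) v))).
  by rewrite /cint mulnDr muln1.
rewrite 2!iint_recl /cint; congr iint.
apply/funext => v; apply: eq_integral => t1 _; apply: eq_integral => t0 _.
congr f; apply/matrixP => i j; rewrite ord1 mxE add0n.
case: (split_ordP i) => {}i ->; rewrite (col_mxEu, col_mxEd) !mxE.
  by rewrite (ord1 i) eqxx /= mulr1n.
by rewrite add0n -[rshift _ _ : nat]/(1 + i)%N mulnDr muln1.
Qed.

Lemma eq_cint n (f g : 'cV[C]_n -> \bar R) : f =1 g -> cint f = cint g.
Proof. by move=> /funext ->. Qed.


(** The factor [pi / g] is moved into the exponent so that the result again has the shape of an
    integrand of [cint_gauss]. *)
Lemma integral2_expR_quad c p q g : 0 < g ->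
  (\int[mu]_t1 \int[mu]_t0
     (expR (c + 2 * (p * t0 + q * t1) - g * (t0 ^+ 2 + t1 ^+ 2)))%:E
   = (expR (ln (pi / g) + (c + (p ^+ 2 + q ^+ 2) / g)))%:E)%E.
Proof.
move=> g0.
have pg0 : 0 < Num.sqrt (pi / g) :> R by rewrite sqrtr_gt0 divr_gt0 ?pi_gt0.
have lnE : ln (pi / g) = ln (Num.sqrt (pi / g)) + ln (Num.sqrt (pi / g)) :> R.
  by rewrite -lnM ?posrE // -expr2 sqr_sqrtr // divr_ge0 ?pi_ge0 ?ltW.
transitivity (\int[mu]_t1 (expR ((ln (Num.sqrt (pi / g)) + c + p ^+ 2 / g)
   + 2 * q * t1 - g * t1 ^+ 2))%:E)%E.
  apply: eq_integral => t1 _.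
  transitivity (\int[mu]_t0
    (expR ((c + 2 * q * t1 - g * t1 ^+ 2) + 2 * p * t0 - g * t0 ^+ 2))%:E)%E.
    by apply: eq_integral => t0 _; congr (expR _)%:E; ring.
  rewrite integral_expR_quad // -[X in (X * _)%:E](lnK (x := Num.sqrt _)) ?posrE //.
  by rewrite -expRD; congr (expR _)%:E; ring.
rewrite integral_expR_quad // -[X in (X * _)%:E](lnK (x := Num.sqrt _)) ?posrE //.
by rewrite -expRD lnE; congr (expR _)%:E; ring.
Qed.

Lemma integral2_expR_affine c p q :
  (\int[mu]_t1 \int[mu]_t0 (expR (c + 2 * (p * t0 + q * t1)))%:E = +oo)%E.
Proof.
rewrite -[RHS](iint_pinfty 1) /=; apply: eq_integral => t1 _.
rewrite -[RHS](integral_expR_affine (c + 2 * q * t1) p).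
by apply: eq_integral => t0 _; congr (expR _)%:E; ring.
Qed.

(** One complex coordinate of variance [s]: linear terms average to 0. [K] stands for the weight of
    the coordinates still to be integrated. *)
Lemma integral2_quad_expR_sq a b0 b1 c K s : 0 < s ->
  (\int[mu]_t1 \int[mu]_t0
     ((a + b0 * t0 + b1 * t1 + c * (t0 ^+ 2 + t1 ^+ 2))
      * (expR (- (t0 ^+ 2 + t1 ^+ 2) / s) / (pi * s) * K))%:E
   = ((a + c * s) * K)%:E)%E.
Proof.
move=> s0; pose r : R := Num.sqrt (pi * s).
have ps0 : 0 < pi * s by rewrite mulr_gt0 ?pi_gt0.
have r2 : pi * s = r * r by rewrite -expr2 sqr_sqrtr ?ltW.
have r0 : r != 0 by rewrite gt_eqF // sqrtr_gt0.
transitivity (\int[mu]_t1 (((a + c * (s / 2)) * (K / r) + b1 * (K / r) * t1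
   + c * (K / r) * t1 ^+ 2) * expR (- t1 ^+ 2 / s))%:E)%E.
  apply: eq_integral => t1 _; pose k := expR (- t1 ^+ 2 / s) * K / (r * r).
  transitivity (\int[mu]_t0 (((a + b1 * t1 + c * t1 ^+ 2) * k + b0 * k * t0
    + c * k * t0 ^+ 2) * expR (- t0 ^+ 2 / s))%:E)%E.
    apply: eq_integral => t0 _; congr EFin; rewrite /k r2.
    have -> : - (t0 ^+ 2 + t1 ^+ 2) / s = - t0 ^+ 2 / s + - t1 ^+ 2 / s.
      by rewrite -mulrDl opprD.
    by rewrite expRD; field.
  by rewrite integral_quad_expR_sq // -/r /k; congr EFin; field.
by rewrite integral_quad_expR_sq // -/r; congr EFin; field.
Qed.

(** * Gram matrices and Schur complements *)

Definition schur m n (a : 'cV[C]_m) (A : 'M[C]_(m, n)) : 'M[C]_(m, n) :=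
  A - ((sqnorm a)^-1)%:C%C *: (a *m (ctr a *m A)).

Lemma gram_cV m (a : 'cV[C]_m) : ctr a *m a = (sqnorm a)%:C%C%:M.
Proof. by apply/matrixP => i j; rewrite !ord1 -[LHS]/(ip a a) ip_sqnorm mxE mulr1n. Qed.

Lemma real_divff (g : R) : g != 0 -> (g^-1)%:C%C * g%:C%C = 1.
Proof. by move=> g0; rewrite -rmorphM mulVf. Qed.

(** [schur a A] is [A] with its columns projected orthogonally to [a]. Since the projection is
    Hermitian and idempotent, the Gram matrix loses a single rank-one term. *)
Lemma gram_schur m n (a : 'cV[C]_m) (A : 'M[C]_(m, n)) : sqnorm a != 0 ->
  ctr (schur a A) *m schur a A
  = ctr A *m A - ((sqnorm a)^-1)%:C%C *: (ctr A *m a *m (ctr a *m A)).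
Proof.
move=> g0; rewrite /schur ctrB ctrZ conjc_real !ctrM ctrK mulmxBr !mulmxBl.
rewrite -!scalemxAl -!scalemxAr -!mulmxA [ctr a *m (a *m _)]mulmxA gram_cV.
rewrite mul_scalar_mx -!scalemxAr scalerA real_divff // scale1r.
by rewrite subrr subr0.
Qed.

Lemma gram_row_mx m n (a : 'cV[C]_m) (A : 'M[C]_(m, n)) :
  ctr (row_mx a A) *m row_mx a A
  = block_mx (sqnorm a)%:C%C%:M (ctr a *m A) (ctr A *m a) (ctr A *m A).
Proof. by rewrite ctr_row_mx mul_col_row gram_cV. Qed.

(** Block elimination: a unit lower triangular factor clears the lower left block and leaves the
    Schur complement. *)
Lemma det_gram_schur m n (a : 'cV[C]_m) (A : 'M[C]_(m, n)) : sqnorm a != 0 ->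
  \det (ctr (row_mx a A) *m row_mx a A)
  = (sqnorm a)%:C%C * \det (ctr (schur a A) *m schur a A).
Proof.
move=> g0; rewrite gram_row_mx gram_schur //.
set k := ((sqnorm a)^-1)%:C%C.
have -> : block_mx (sqnorm a)%:C%C%:M (ctr a *m A) (ctr A *m a) (ctr A *m A)
  = block_mx 1%:M 0 (k *: (ctr A *m a)) 1%:M
    *m block_mx (sqnorm a)%:C%C%:M (ctr a *m A) 0
         (ctr A *m A - k *: (ctr A *m a *m (ctr a *m A))).
  rewrite mulmx_block !mul1mx !mul0mx ?mulmx0 !addr0 mul_mx_scalar scalerA.
  by rewrite mulrC real_divff // scale1r -scalemxAl addrC subrK.
by rewrite det_mulmx det_lblock det_ublock !det1 !mul1r det_scalar1.
Qed.

(** Pythagoras: the component of [A *m x] along [a] is removed. *)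
Lemma sqnorm_schur m n (a : 'cV[C]_m) (A : 'M[C]_(m, n)) x : sqnorm a != 0 ->
  sqnorm (schur a A *m x) = sqnorm (A *m x)
   - (complex.Re (ip a (A *m x)) ^+ 2 + complex.Im (ip a (A *m x)) ^+ 2) / sqnorm a.
Proof.
move=> g0; set w := A *m x.
have -> : schur a A *m x = - (((sqnorm a)^-1)%:C%C * ip a w) *: a + w.
  rewrite /schur mulmxBl -scalemxAl -!mulmxA -/w addrC; congr (_ + _).
  rewrite scaleNr -scalerA; congr (- (_ *: _)).
  by rewrite (mx11_scalar (ctr a *m w)) mul_mx_scalar.
rewrite sqnormDZ; case: (ip a w) => u v /=; field.
by rewrite g0.
Qed.

Lemma logdet0 (M : 'M[C]_0) : logdet M = 0.
Proof. by rewrite /logdet det_mx00 ln1. Qed.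

Lemma logdet_gram_schur m n (a : 'cV[C]_m) (A : 'M[C]_(m, n)) : 0 < sqnorm a ->
  0 < \det (ctr (schur a A) *m schur a A) ->
  logdet (ctr (row_mx a A) *m row_mx a A)
  = ln (sqnorm a) + logdet (ctr (schur a A) *m schur a A).
Proof.
move=> a0 dp; rewrite /logdet det_gram_schur ?gt_eqF // ReZ lnM ?posrE //.
by move: dp; rewrite ltcE => /andP[].
Qed.

(* Peeling off the first complex coordinate turns [A = row_mx a A'] into
   [A' - a a^* A' / |a|^2], the Schur complement at the level of Gram matrices. *)
Lemma cint_gauss n m (A : 'M[C]_(m, n)) (b : 'cV[C]_n) (c : R) :
  let I := cint (fun x => (expR (c + 2 * complex.Re (ip b x) - sqnorm (A *m x)))%:E) in
  (\det (ctr A *m A) = 0 /\ I = +oo%E) \/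
  (0 < \det (ctr A *m A) /\ forall h, ctr A *m A *m h = b ->
     I = (expR (c + n%:R * ln pi - logdet (ctr A *m A) + complex.Re (ip b h)))%:E).
Proof.
elim: n m A b c => [|n IH] m A b c /=.
  right; rewrite det_mx00; split=> [|h _]; first exact: ltr01.
  rewrite /cint /=; congr (expR _)%:E.
  have ip0 (x y : 'cV[C]_0) : ip x y = 0 by rewrite /ip /sc mxE big_ord0.
  rewrite !ip0 (flatmx0 (cvecAt _ _ _)) /sqnorm -/(ip _ _) mulmx0.
  by rewrite logdet0 {1}/ip mulmx0 /sc mxE /=; ring.
pose a := lsubmx (A : 'M[C]_(m, 1 + n)); pose A' := rsubmx (A : 'M[C]_(m, 1 + n)).
pose b0 := sc (usubmx (b : 'cV[C]_(1 + n))); pose b' := dsubmx (b : 'cV[C]_(1 + n)).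
have EA : A = row_mx a A' by rewrite hsubmxK.
have Eb : b = col_mx b0%:M b' by rewrite /b0 -mx11_scalar vsubmxK.
rewrite {}EA {}Eb; clearbody a A' b0 b'; move: a A' b0 b' => {A b} a A b0 b.
(* Real and imaginary parts of the linear coefficient of the first coordinate when the remaining
   coordinates [x] are fixed. *)
pose p x := complex.Re (b0 - ip a (A *m x)).
pose q x := complex.Im (b0 - ip a (A *m x)).
have I1 : cint (fun x : 'cV[C]_(1 + n) =>
    (expR (c + 2 * complex.Re (ip (col_mx b0%:M b) x)
      - sqnorm (row_mx a A *m x)))%:E)
  = cint (fun x => \int[mu]_t1 \int[mu]_t0
     (expR ((c + 2 * complex.Re (ip b x) - sqnorm (A *m x))
        + 2 * (p x * t0 + q x * t1) - sqnorm a * (t0 ^+ 2 + t1 ^+ 2)))%:E)%E.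
  rewrite cint_recl; apply: eq_cint => x.
  apply: eq_integral => t1 _; apply: eq_integral => t0 _; congr (expR _)%:E.
  rewrite ip_col ip_scalar mul_row_col mul_mx_scalar sqnormDZ /p /q.
  case: (b0) (ip a _) (ip b x) => [u v] [u1 v1] [u2 v2] /=; ring.
rewrite {}I1.
(* If [a = 0], the exponent is affine in the first coordinate and the inner integral is already
   infinite. *)
have [g0|g0] := eqVneq (sqnorm a) 0.
  left; split.
    rewrite gram_row_mx g0 (sqnorm_eq0 g0) mulmx0 ctr0 mul0mx.
    have -> : (0 : R)%:C%C%:M = 0 :> 'M[C]_1.
      by apply/matrixP => i j; rewrite !mxE mul0rn.
    by rewrite (@det_ublock _ 1 n) det0 mul0r.
  transitivity (cint (fun _ : 'cV[C]_n => +oo : \bar R)%E).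
    apply: eq_cint => x.
    rewrite -[RHS](integral2_expR_affine
      (c + 2 * complex.Re (ip b x) - sqnorm (A *m x)) (p x) (q x)).
    apply: eq_integral => t1 _; apply: eq_integral => t0 _.
    by rewrite g0 mul0r subr0.
  exact: iint_pinfty.
have gp : 0 < sqnorm a by rewrite lt_def g0 sqnorm_ge0.
(* Linear and constant terms left after completing the square in the first coordinate. *)
pose b'' := b - (((sqnorm a)^-1)%:C%C * b0) *: (ctr A *m a).
pose c'' := c + ln (pi / sqnorm a) + (complex.Re b0 ^+ 2 + complex.Im b0 ^+ 2) / sqnorm a.
have I2 : cint (fun x => \int[mu]_t1 \int[mu]_t0
     (expR ((c + 2 * complex.Re (ip b x) - sqnorm (A *m x))
        + 2 * (p x * t0 + q x * t1) - sqnorm a * (t0 ^+ 2 + t1 ^+ 2)))%:E)%E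
  = cint (fun x => (expR (c'' + 2 * complex.Re (ip b'' x) - sqnorm (schur a A *m x)))%:E).
  apply: eq_cint => x; rewrite integral2_expR_quad //; congr (expR _)%:E.
  rewrite sqnorm_schur // /c'' /b'' /p /q ipDl ipNl ipZl -ip_mulr.
  case: (b0) (ip a _) (ip b x) => [u v] [u1 v1] [u2 v2] /=; field.
  by rewrite g0.
rewrite {}I2 det_gram_schur //.
have [[d0 ->]|[dp IHh]] := IH m (schur a A) b'' c''.
  by left; rewrite d0 mulr0.
right; split; first by rewrite mulr_gt0 // ltcR.
move=> h; rewrite gram_row_mx.
pose h0 := sc (usubmx (h : 'cV[C]_(1 + n))); pose h' := dsubmx (h : 'cV[C]_(1 + n)).
have -> : h = col_mx h0%:M h' by rewrite /h0 -mx11_scalar vsubmxK.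
clearbody h0 h'; move: h0 h' => {h} h0 h.
rewrite (@mul_block_col _ 1 n 1 n 1) => E.
have e0 := congr1 (fun M : 'cV[C]_(1 + n) => usubmx M) E.
have e' := congr1 (fun M : 'cV[C]_(1 + n) => dsubmx M) E.
rewrite /= !col_mxKu in e0; rewrite /= !col_mxKd in e'.
have E0 : b0 = (sqnorm a)%:C%C * h0 + ip a (A *m h).
  move/matrixP/(_ 0 0): e0.
  by rewrite -scalar_mxM -mulmxA mxE [in X in X + _]mxE [RHS]mxE eqxx !mulr1n => <-.
(* Eliminating [h0] from the block equations shows that the tail of [h] solves the reduced system,
   which is what the induction hypothesis asks for. *)
have Eh : ctr (schur a A) *m schur a A *m h = b''.
  rewrite gram_schur // mulmxBl -scalemxAl -!mulmxA /b'' -{}e' E0.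
  rewrite [ctr a *m _](_ : _ = (ip a (A *m h))%:M); last first.
    by rewrite mulmxA -mulmxA -mx11_scalar.
  rewrite !mul_mx_scalar mulrDr mulrA real_divff // mul1r scalerDl.
  by rewrite -scalemxAr scalerA mulmxA opprD addrACA subrr add0r.
rewrite (IHh _ Eh) -gram_row_mx logdet_gram_schur //; congr (expR _)%:E.
have Ea : ip a (A *m h) = b0 - (sqnorm a)%:C%C * h0 by rewrite E0 addrAC subrr add0r.
rewrite (@ip_col _ 1 n) ip_scalar /c'' /b'' ipDl ipNl ipZl -ip_mulr Ea.
rewrite lnM ?posrE ?pi_gt0 ?invr_gt0 // lnV ?posrE // -natr1.
case: (b0) (h0) (ip b h) => [u v] [u1 v1] [u2 v2] /=; field.
by rewrite g0.
Qed.

(** One variance per entry, so that the signal and the noise can be stacked into a single Gaussian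
    vector. *)
Definition gauss_wt n (s : 'I_n -> R) (x : 'cV[C]_n) : R :=
  \prod_i (expR (- (complex.Re (x i 0) ^+ 2 + complex.Im (x i 0) ^+ 2) / s i)
    / (pi * s i)).

(** The entries are centred and independent: cross terms average to 0, and the squared modulus of
    entry [i] has mean [s i]. *)
Lemma cint_quad_gauss n (M : 'M[C]_n) (c : R) (s : 'I_n -> R) : (forall i, 0 < s i) ->
  cint (fun x => ((c + complex.Re (ip x (M *m x))) * gauss_wt s x)%:E)
  = (c + \sum_i s i * complex.Re (M i i))%:E.
Proof.
elim: n M c s => [|n IH] M c s s0.
  rewrite /cint /= /gauss_wt !big_ord0 mulr1 addr0.
  by rewrite /ip /sc mxE big_ord0 addr0.
pose m0 := sc (ulsubmx (M : 'M[C]_(1 + n))).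
pose r := ursubmx (M : 'M[C]_(1 + n)).
pose l := dlsubmx (M : 'M[C]_(1 + n)).
pose M' := drsubmx (M : 'M[C]_(1 + n)).
have EM : M = block_mx m0%:M r l M' by rewrite /m0 -mx11_scalar submxK.
pose s' i := s (lift ord0 i).
transitivity (cint (fun x : 'cV[C]_n =>
    (((c + s ord0 * complex.Re m0) + complex.Re (ip x (M' *m x))) * gauss_wt s' x)%:E)).
  rewrite (cint_recl (n := n)); apply: eq_cint => x.
  (* Both cross terms with the first coordinate, merged by conjugating one inside the real part;
     they are linear in it and integrate to 0. *)
  pose B := sc (r *m x) + (ip x l)^*%C.
  rewrite (_ : c + s ord0 * complex.Re m0 + _
    = (c + complex.Re (ip x (M' *m x))) + complex.Re m0 * s ord0); last by ring.
  rewrite -(integral2_quad_expR_sq _ (complex.Re B) (complex.Im B) _ _ (s0 ord0)).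
  apply: eq_integral => t1 _; apply: eq_integral => t0 _; congr (_ * _)%:E.
    rewrite EM (@mul_block_col _ 1 n 1 n 1) (@ip_col _ 1 n) -scalar_mxM mul_mx_scalar.
    rewrite (mx11_scalar (r *m x)) -raddfD ip_scalar ipDr ipZr /B -/(sc (r *m x)).
    case: (m0) (sc _) (ip x l) (ip x (M' *m x)) => [a b] [a1 b1] [a2 b2] [a3 b3] /=; ring.
  rewrite /gauss_wt big_ord_recl; congr (_ * _).
    have -> : col_mx (t0 +i* t1)%C%:M x ord0 0 = (t0 +i* t1)%C.
      transitivity (col_mx (t0 +i* t1)%C%:M x (lshift n ord0) 0).
        by congr (col_mx _ _ _ _); exact: val_inj.
      by rewrite (@col_mxEu _ 1) mxE eqxx.
    by [].
  apply: eq_bigr => i _; rewrite /s' -!rshift1.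
  by rewrite (@col_mxEd _ 1 n).
rewrite IH; last by move=> i; exact: s0.
rewrite big_ord_recl addrA; congr (_ + _ * complex.Re _ + _)%:E.
  by rewrite /m0 /sc !mxE; congr (M _ _); apply/val_inj.
apply: eq_bigr => i _; rewrite /M' !mxE /s' -rshift1.
by congr (_ * complex.Re (M _ _)); apply/val_inj.
Qed.

End ComplexIntegral.

(** * Frobenius norm and log-determinants *)

Section Frobenius.
Variable R : realType.
Local Notation C := R[i].

Definition fro m n (A : 'M[C]_(m, n)) : R := complex.Re (\tr (ctr A *m A)).

Lemma froE m n (A : 'M[C]_(m, n)) : fro A = \sum_j sqnorm (A *m delta_mx j 0).
Proof.
rewrite /fro /mxtrace Re_sum; apply: eq_bigr => j _; congr complex.Re.
rewrite -colE /sc !mxE; apply: eq_bigr => i _; by rewrite !mxE.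
Qed.

Lemma fro_ge0 m n (A : 'M[C]_(m, n)) : 0 <= fro A.
Proof. by rewrite froE sumr_ge0 // => j _; rewrite sqnorm_ge0. Qed.

Lemma fro_ctr m n (A : 'M[C]_(m, n)) : fro (ctr A) = fro A.
Proof. by rewrite /fro ctrK mxtrace_mulC. Qed.

Lemma fro1 n : fro (1%:M : 'M[C]_n) = n%:R.
Proof. by rewrite /fro ctr1 mulmx1 mxtrace1 -(rmorph_nat (real_complex R)). Qed.

Lemma fro0 m n : fro (0 : 'M[C]_(m, n)) = 0.
Proof. by rewrite /fro mulmx0 mxtrace0. Qed.

Lemma fro_row_mx m n p (A : 'M[C]_(m, n)) (B : 'M[C]_(m, p)) :
  fro (row_mx A B) = fro A + fro B.
Proof. by rewrite /fro ctr_row_mx mul_col_row mxtrace_block ReD. Qed.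

Lemma fro_col_mx m n p (A : 'M[C]_(m, n)) (B : 'M[C]_(p, n)) :
  fro (col_mx A B) = fro A + fro B.
Proof. by rewrite -fro_ctr ctr_col_mx fro_row_mx !fro_ctr. Qed.

Lemma fro_block_mx m n p q (A : 'M[C]_(m, n)) (B : 'M[C]_(m, q))
    (D : 'M[C]_(p, n)) (E : 'M[C]_(p, q)) :
  fro (block_mx A B D E) = fro A + fro B + (fro D + fro E).
Proof. by rewrite fro_col_mx !fro_row_mx. Qed.

Lemma fro_diag_mul m n (d : 'rV[C]_m) (A : 'M[C]_(m, n)) :
  fro (diag_mx d *m A) = \sum_i (complex.Re (d 0 i) ^+ 2 + complex.Im (d 0 i) ^+ 2)
     * complex.Re ((A *m ctr A) i i).
Proof.
rewrite -fro_ctr /fro ctrK /mxtrace Re_sum; apply: eq_bigr => i _.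
rewrite mul_diag_mx !mxE !Re_sum mulr_sumr; apply: eq_bigr => j _.
rewrite !mxE; case: (d 0 i) (A i j) => [u v] [x y] /=; ring.
Qed.

(** An orthogonal projection lengthens no column. *)
Lemma fro_schur_le m n (a : 'cV[C]_m) (A : 'M[C]_(m, n)) : 0 < sqnorm a ->
  fro (schur a A) <= fro A.
Proof.
move=> a0; rewrite !froE ler_sum // => j _; rewrite sqnorm_schur ?gt_eqF //.
by rewrite gerBl divr_ge0 ?sqnorm_ge0 // addr_ge0 ?sqr_ge0.
Qed.

Lemma Re_gt0 (x : C) : 0 < x -> 0 < complex.Re x.
Proof. by rewrite ltcE => /andP[]. Qed.

Lemma ln_le_subr1 (x : R) : 0 < x -> ln x <= x - 1.
Proof. by move=> x0; rewrite -[in leLHS](subrKC 1 x) le_ln1Dx // ltrBrDl subrr. Qed.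

(* Induction on Schur complements: each step splits off the squared norm [t] of a
   column and uses [ln t <= t - 1]. *)
Lemma logdet_gram_le m n (A : 'M[C]_(m, n)) : 0 < \det (ctr A *m A) ->
  logdet (ctr A *m A) <= fro A - n%:R.
Proof.
elim: n m A => [|n IH] m A dA.
  by rewrite logdet0 subr0 fro_ge0.
pose a := lsubmx (A : 'M[C]_(m, 1 + n)); pose A' := rsubmx (A : 'M[C]_(m, 1 + n)).
have EA : A = row_mx a A' by rewrite hsubmxK.
rewrite {}EA in dA *; clearbody a A'; move: a A' dA => {A} a A dA.
have [g0|g0] := eqVneq (sqnorm a) 0.
  move: dA; rewrite gram_row_mx g0 (sqnorm_eq0 g0) mulmx0 ctr0 mul0mx.
  have -> : (0 : R)%:C%C%:M = 0 :> 'M[C]_1.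
    by apply/matrixP => i j; rewrite !mxE mul0rn.
  by rewrite (@det_ublock _ 1 n) det0 mul0r ltxx.
have gp : 0 < sqnorm a by rewrite lt_def g0 sqnorm_ge0.
move: dA; rewrite det_gram_schur // => dA.
have dS : 0 < \det (ctr (schur a A) *m schur a A).
  by move: dA; rewrite pmulr_rgt0 // ltcR.
rewrite logdet_gram_schur // (@fro_row_mx _ 1) -natr1.
have := IH _ _ dS; have := fro_schur_le A gp; have := ln_le_subr1 gp.
have -> : fro a = sqnorm a by rewrite /fro gram_cV mxtrace_scalar mulr1n.
lra.
Qed.

Lemma det_gram_gt0 n (A : 'M[C]_n) : (0 < \det (ctr A *m A)) = (\det A != 0).
Proof.
by rewrite lt_def det_gram_ge0 andbT det_mulmx det_ctr mulf_eq0 conjc_eq0 orbb.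
Qed.

(** Since the Gram determinant is the squared modulus of the determinant, this applies to a matrix
    that has the determinant of a product without being that product. *)
Lemma logdet_gramM n (A B D : 'M[C]_n) : \det B != 0 -> \det D != 0 ->
  \det A = \det B * \det D ->
  logdet (ctr A *m A) = logdet (ctr B *m B) + logdet (ctr D *m D).
Proof.
rewrite -!det_gram_gt0 => B0 D0 E.
rewrite /logdet -lnM ?posrE ?Re_gt0 //; congr ln.
have -> : \det (ctr A *m A) = \det (ctr B *m B) * \det (ctr D *m D).
  by rewrite !det_mulmx !det_ctr E rmorphM; ring.
move: B0 D0; rewrite !ltcE.
case: (\det (ctr B *m B)) (\det (ctr D *m D)) => [u v] [x y] /=.
by move=> /andP[/eqP-> _] /andP[/eqP-> _]; rewrite mul0r subr0.
Qed.

(** The entry is the squared norm of a row of an invertible matrix. *)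
Lemma fro_inv_row_gt0 k (S : 'M[C]_k) i : S \in unitmx ->
  0 < complex.Re ((invmx S *m ctr (invmx S)) i i).
Proof.
move=> uS; set x := ctr (row i (invmx S)).
have -> : complex.Re ((invmx S *m ctr (invmx S)) i i) = sqnorm x.
  rewrite /sqnorm /sc /x ctrK; congr complex.Re.
  by rewrite !mxE; apply: eq_bigr => j _; rewrite !mxE.
rewrite lt_def sqnorm_ge0 andbT; apply/eqP => /sqnorm_eq0 x0.
have r0 : row i (invmx S) = 0 by rewrite -[LHS]ctrK -/x x0 ctr0.
have : row i (invmx S *m S) 0 i = 0 by rewrite row_mul r0 mul0mx mxE.
by rewrite mulVmx // !mxE eqxx => /eqP; rewrite oner_eq0.
Qed.
End Frobenius.

(** * Punctured matrices and the filter of the augmented channel *)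

Section Punctured.
Variables (R : realType) (nu k : nat).
Local Notation C := R[i].
Variable La : 'M[C]_(nu + k).
Hypothesis La_tri : lower_tri_posdiag La.

Let P := ulsubmx La.
Let Q := dlsubmx La.
Let S := drsubmx La.
Let Sig := Sigma_a S.
Let q i := complex.Re ((invmx S *m ctr (invmx S)) i i).

Lemma La_block : La = block_mx P 0 Q S.
Proof.
rewrite -[LHS]submxK; congr block_mx; apply/matrixP => i j; rewrite !mxE.
by rewrite (La_tri.1) //= ltn_addr.
Qed.

Lemma det_La_neq0 : \det La != 0.
Proof.
rewrite det_trig; last by apply/is_trig_mxP => i j; exact: La_tri.1.
by apply/prodf_neq0 => i _; rewrite gt_eqF // La_tri.2.
Qed.

Lemma La_unit : La \in unitmx. Proof. by rewrite unitmxE unitfE det_La_neq0. Qed.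

Lemma det_PS_neq0 : (\det P != 0) && (\det S != 0).
Proof. by have := det_La_neq0; rewrite {1}La_block det_lblock mulf_eq0 negb_or. Qed.

Lemma S_unit : S \in unitmx.
Proof. by rewrite unitmxE unitfE; case/andP: det_PS_neq0. Qed.

Lemma q_gt0 i : 0 < q i. Proof. exact/fro_inv_row_gt0/S_unit. Qed.

(** The lower rows are multiplied by [Sig *m invmx S], which turns [S] into the real diagonal [Sig];
    hence the punctured shape. *)
Lemma L_apE : L_ap La = block_mx P 0 (Sig *m invmx S *m Q) Sig.
Proof.
rewrite /L_ap [in X in _ *m X]La_block mulmx_block !mul1mx !mul0mx ?mulmx0 !addr0.
by rewrite ?add0r mulmxKV ?S_unit.
Qed.

Lemma det_Sig_neq0 : \det Sig != 0.
Proof.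
rewrite det_diag; apply/prodf_neq0 => i _; rewrite mxE.
by rewrite (fmorph_eq0 (real_complex R)) gt_eqF // invr_gt0 sqrtr_gt0 q_gt0.
Qed.

Lemma det_L_ap : \det (L_ap La) = \det P * \det Sig.
Proof. by rewrite L_apE det_lblock. Qed.

Lemma det_L_ap_neq0 : \det (L_ap La) != 0.
Proof.
by rewrite det_L_ap mulf_neq0 ?det_Sig_neq0 //; case/andP: det_PS_neq0.
Qed.

Lemma punctured_L_ap : punctured (L_ap La).
Proof.
rewrite L_apE; split; rewrite ?block_mxKul ?block_mxKur ?block_mxKdr //.
- by move=> i j ij; rewrite !mxE La_tri.1.
- by move=> i j ij; rewrite !mxE (negPf ij) mulr0n.
- by move=> i; rewrite !mxE eqxx mulr1n.
Qed.

Lemma fro_Sig_invS : fro (Sig *m invmx S) = k%:R.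
Proof.
rewrite fro_diag_mul; transitivity (\sum_(i < k) (1 : R)).
  2: by rewrite sumr_const card_ord.
apply: eq_bigr => i _.
rewrite mxE /= expr0n addr0 -/(q i) exprVn sqr_sqrtr ?ltW ?q_gt0 //.
by rewrite mulVf // gt_eqF // q_gt0.
Qed.

(** Cancelling [La] leaves the filter itself: an identity block and [k] rows of [invmx S] normalized
    to unit length. *)
Lemma fro_L_ap : fro (L_ap La *m invmx La) = (nu + k)%:R.
Proof.
rewrite /L_ap mulmxK ?La_unit // fro_block_mx fro1 !fro0 fro_Sig_invS.
by rewrite addr0 add0r natrD.
Qed.

Lemma punctured_logdet_le (J : 'M[C]_(nu + k)) : punctured J -> \det J != 0 ->
  logdet (ctr J *m J) - fro (J *m invmx La)
  <= logdet (ctr (L_ap La) *m L_ap La) - (nu + k)%:R.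
Proof.
move=> [_ J0 Jd _] dJ.
pose J1 := ulsubmx J; pose J2 := dlsubmx J; pose J3 := drsubmx J.
have EJ : J = block_mx J1 0 J2 J3 by rewrite -[LHS]submxK J0.
have dJ' : \det J = \det J1 * \det J3 by rewrite {1}EJ det_lblock.
set M := J *m invmx La; pose M1 := ulsubmx M; pose M4 := drsubmx M.
have EM : M *m La = J by rewrite mulmxKV ?La_unit.
have EM4 : M4 *m S = J3.
  rewrite /J3 -[in RHS]EM -[in RHS](submxK M) La_block mulmx_block block_mxKdr.
  by rewrite mulmx0 add0r.
(* [J] and [La] are both block lower triangular, so [M] inherits this shape. *)
have EM2 : ursubmx M = 0.
  have : ursubmx M *m S = 0.
    rewrite -J0 -[in RHS]EM -[in RHS](submxK M) La_block mulmx_block block_mxKur.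
    by rewrite mulmx0 add0r.
  by move=> /(congr1 (mulmx^~ (invmx S))); rewrite mulmxK ?S_unit // mul0mx.
have EM1 : M1 *m P = J1.
  rewrite /J1 -[in RHS]EM -[in RHS](submxK M) La_block mulmx_block block_mxKul.
  by rewrite EM2 mul0mx addr0.
pose d : 'rV[C]_k := \row_i J3 i i.
have EJ3 : J3 = diag_mx d.
  apply/matrixP => i j; rewrite [RHS]mxE [d _ _]mxE.
  by have [->|ij] := eqVneq i j; rewrite ?mulr1n // mulr0n; exact: Jd.
(* Row [i] of [M4] is [J3 i i] times row [i] of [invmx S], whose norm is [sqrt (q i)]. Thus
   [diag_mx t] has the Frobenius norm of [M4], while [diag_mx t *m Sig] is still [J3]. *)
pose t : 'rV[C]_k := \row_i ((Num.sqrt (q i))%:C%C * J3 i i).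
have Et : diag_mx t *m Sig = J3.
  rewrite EJ3 (_ : Sig = diag_mx (\row_i ((Num.sqrt (q i))^-1)%:C%C)) // mulmx_diag.
  congr diag_mx; apply/rowP => i; rewrite !mxE mulrAC.
  rewrite -rmorphM divff ?mul1r //.
  by rewrite gt_eqF // sqrtr_gt0 q_gt0.
have fM4 : fro M4 = fro (diag_mx t).
  have -> : M4 = diag_mx d *m invmx S by rewrite -EJ3 -EM4 mulmxK ?S_unit.
  rewrite -[diag_mx t]mulmx1 !fro_diag_mul; apply: eq_bigr => i _.
  rewrite -/(q i) ctr1 mulmx1 !mxE eqxx mulr1.
  have := sqr_sqrtr (ltW (q_gt0 i)); move: (Num.sqrt _) => r <-.
  by case: (J _ _) => u v /=; ring.
(* Dropping the lower left block of [M] can only decrease the norm and keeps the determinant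
   relation with [L_ap La]. *)
pose T := block_mx M1 0 0 (diag_mx t).
have dT : \det J = \det T * \det (L_ap La).
  by rewrite dJ' -EM1 -Et det_L_ap det_lblock !det_mulmx; ring.
have T0 : \det T != 0 by apply: contraNneq dJ => T0; rewrite dT T0 mul0r.
have : logdet (ctr T *m T) <= fro T - (nu + k)%:R.
  by apply: logdet_gram_le; rewrite det_gram_gt0.
rewrite (logdet_gramM T0 det_L_ap_neq0 dT).
have fM : fro T <= fro M.
  rewrite -(submxK M) !fro_block_mx !fro0 -/M1 -/M4 EM2 fro0 fM4.
  by rewrite addr0 add0r lerD2l lerDr fro_ge0.
move: (logdet (ctr T *m T)) (logdet (ctr (L_ap La) *m _)) (fro T) (fro M) fM.
by move=> a b u w; lra.
Qed.

End Punctured.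

(** * Closed form of the information rate *)

Section Expectation.
Variable R : realType.
Local Notation C := R[i].

Lemma cn_pdfE n (s : R) (x : 'cV[C]_n) :
  cn_pdf s x = gauss_wt (fun=> s) x.
Proof.
rewrite /cn_pdf /gauss_wt big_split /= prodfV prodr_const card_ord.
by rewrite -expR_sum -mulr_suml sumrN sqnormE.
Qed.

Lemma cvecAtD n m (v : nat -> R) :
  cvecAt 0 (n + m) v = col_mx (cvecAt 0 n v) (cvecAt (2 * n) m v).
Proof.
apply/matrixP => i j; rewrite mxE add0n.
case: (split_ordP i) => {}i ->; rewrite (col_mxEu, col_mxEd) !mxE //.
by rewrite -[rshift _ _ : nat]/(n + i)%N mulnDr.
Qed.

Section Model.
Variables (Nr Nt : nat) (H : 'M[C]_(Nr, Nt)) (Es N0 : R).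
Hypotheses (Es0 : 0 < Es) (N00 : 0 < N0).

Let s (i : 'I_(Nt + Nr)) : R := if (i < Nt)%N then Es else N0.

Lemma gauss_wt_col (x : 'cV[C]_Nt) (z : 'cV[C]_Nr) :
  gauss_wt s (col_mx x z) = cn_pdf Es x * cn_pdf N0 z.
Proof.
rewrite !cn_pdfE /gauss_wt big_split_ord /=; congr (_ * _); apply: eq_bigr => i _.
  by rewrite col_mxEu /s /= ltn_ord.
by rewrite col_mxEd /s /= ltnNge leq_addr.
Qed.

Lemma ExyE g : Exy H Es N0 g = cint (fun u : 'cV[C]_(Nt + Nr) =>
  g (usubmx u) (H *m usubmx u + dsubmx u)%R * (gauss_wt s u)%:E)%E.
Proof.
rewrite /Exy /cint mulnDr; congr iint; apply/funext => v.
by rewrite cvecAtD col_mxKu col_mxKd gauss_wt_col.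
Qed.

(** The stacked signal and noise have block diagonal covariance, so only the diagonal blocks of [M]
    contribute. *)
Lemma Exy_quad g c (M : 'M[C]_(Nt + Nr)) :
  (forall x z, g x (H *m x + z)
     = (c + complex.Re (ip (col_mx x z) (M *m col_mx x z)))%:E) ->
  Exy H Es N0 g = (c + (Es * complex.Re (\tr (ulsubmx M))
    + N0 * complex.Re (\tr (drsubmx M))))%:E.
Proof.
move=> gE; rewrite ExyE.
transitivity (cint (fun u : 'cV[C]_(Nt + Nr) =>
    ((c + complex.Re (ip u (M *m u))) * gauss_wt s u)%:E)).
  by apply: eq_cint => u; rewrite gE vsubmxK EFinM.
rewrite cint_quad_gauss; last by move=> i; rewrite /s; case: ifP.
congr (_ + _)%:E; rewrite big_split_ord /=; congr (_ + _).
  rewrite /mxtrace Re_sum mulr_sumr; apply: eq_bigr => i _.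
  by rewrite /s /= ltn_ord !mxE.
rewrite /mxtrace Re_sum mulr_sumr; apply: eq_bigr => i _.
by rewrite /s /= ltnNge leq_addr !mxE.
Qed.

Lemma Exy_ln_pm_cond F G :
  Exy H Es N0 (fun x y => (ln (pm_cond Es F G y x))%:E)
  = (2 * Es * complex.Re (\tr (ctr H *m F)) - Es * complex.Re (\tr G) + Nt%:R)%:E.
Proof.
(* Only the real part of the form matters, so [M] may be non-Hermitian: the factor 2 of the cross
   term is put entirely in the left blocks, after expanding [y = H *m x + z]. *)
pose M := block_mx (ctr H *m F + ctr H *m F - G + (Es^-1)%:C%C%:M) 0
  (F + F) (0 : 'M[C]_Nr).
rewrite (@Exy_quad _ 0 M) => [|x z].
  rewrite /M block_mxKul block_mxKdr mxtrace0 /= mulr0 addr0 add0r; congr EFin.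
  rewrite !mxtraceD linearN /= !ReD ReN mxtrace_scalar.
  have -> : complex.Re ((Es^-1)%:C%C *+ Nt) = Es^-1 *+ Nt.
    by rewrite -(rmorphMn (real_complex R)).
  rewrite -[Es^-1 *+ Nt]mulr_natr; field.
  by rewrite gt_eqF.
rewrite /pm_cond expRK add0r; congr EFin.
rewrite /M mul_block_col !mul0mx !addr0 ip_col !mulmxDl !ipDr mulNmx ipNr.
rewrite mul_scalar_mx ipZr ip_sqnorm !ReD ReN.
have -> : sc (ctr (H *m x + z) *m F *m x) = ip x (ctr H *m F *m x) + ip z (F *m x).
  by rewrite -!mulmxA -[LHS]/(ip _ _) ipDl [in RHS]ip_mulr ctrK.
have -> : sc (ctr x *m G *m x) = ip x (G *m x) by rewrite -mulmxA.
rewrite ReD ReZ /=; ring.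
Qed.

(** The term [sqnorm x / Es] of [pm_cond] cancels the exponent of the prior, leaving the integrand
    of [cint_gauss]. *)
Lemma pm_margE (F : 'M[C]_(Nr, Nt)) (J : 'M[C]_Nt) (y : 'cV[C]_Nr) :
  let b := ctr F *m y in
  pm_marg Es F (ctr J *m J) y = cint (fun x =>
    (expR (- (Nt%:R * ln (pi * Es)) + 2 * complex.Re (ip b x) - sqnorm (J *m x)))%:E).
Proof.
move=> b; congr iint; apply/funext => v; rewrite /=; set x := cvecAt 0 Nt v.
congr EFin.
have -> : cn_pdf Es x = expR (- sqnorm x / Es - Nt%:R * ln (pi * Es)).
  rewrite /cn_pdf expRD expRN expRM_natl lnK // posrE.
  by rewrite mulr_gt0 // pi_gt0.
rewrite /pm_cond -expRD; congr expR.
have -> : sc (ctr y *m F *m x) = ip b x by rewrite /b /ip ctrM ctrK.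
have -> : complex.Re (sc (ctr x *m (ctr J *m J) *m x)) = sqnorm (J *m x).
  by rewrite /sqnorm ctrM !mulmxA.
ring.
Qed.

Lemma elog_pm_marg_singular (F : 'M[C]_(Nr, Nt)) (J : 'M[C]_Nt) (y : 'cV[C]_Nr) :
  \det J = 0 ->
  elog (pm_marg Es F (ctr J *m J) y) = +oo%E.
Proof.
move=> J0; rewrite pm_margE.
have [[_ ->] //|[]] := cint_gauss J (ctr F *m y) (- (Nt%:R * ln (pi * Es))).
by rewrite det_gram_gt0 J0 eqxx.
Qed.

Lemma elog_pm_marg (F : 'M[C]_(Nr, Nt)) (J : 'M[C]_Nt) (y : 'cV[C]_Nr) : \det J != 0 ->
  elog (pm_marg Es F (ctr J *m J) y)
  = (- (Nt%:R * ln Es + logdet (ctr J *m J))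
     + complex.Re (ip y (F *m invmx (ctr J *m J) *m ctr F *m y)))%:E.
Proof.
move=> J0; rewrite pm_margE.
have uG : ctr J *m J \in unitmx by rewrite unitmxE unitfE gt_eqF // det_gram_gt0.
have [[d0 _]|[_ E]] := cint_gauss J (ctr F *m y) (- (Nt%:R * ln (pi * Es))).
  by have := det_gram_gt0 J; rewrite d0 ltxx J0.
rewrite (E (invmx (ctr J *m J) *m (ctr F *m y))); last by rewrite mulKVmx.
rewrite /elog expR_gt0 expRK lnM ?posrE ?pi_gt0 //; congr EFin.
by rewrite -!mulmxA [in RHS]ip_mulr; ring.
Qed.

Lemma Exy_pinfty : Exy H Es N0 (fun _ _ => +oo%E) = +oo%E.
Proof.
rewrite ExyE -[RHS](@iint_pinfty R (2 * (Nt + Nr))); congr iint; apply/funext => v.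
rewrite gt0_mulye // lte_fin prodr_gt0 // => i _.
by rewrite divr_gt0 ?expR_gt0 // mulr_gt0 ?pi_gt0 // /s; case: ifP.
Qed.

(* The first expectation is irrelevant here: [x - +oo = -oo] for every extended
   real [x], including [+oo]. *)
Lemma I_LB_singular (F : 'M[C]_(Nr, Nt)) (J : 'M[C]_Nt) : \det J = 0 ->
  I_LB H Es N0 F (ctr J *m J) = -oo%E.
Proof.
move=> J0; rewrite /I_LB.
rewrite (_ : (fun _ y => elog _) = (fun _ _ => +oo%E)); last first.
  by apply/funext => x; apply/funext => y; rewrite elog_pm_marg_singular.
by rewrite Exy_pinfty /= addeNy.
Qed.

Lemma I_LB_regular (F : 'M[C]_(Nr, Nt)) (J : 'M[C]_Nt) : \det J != 0 ->
  let E := F *m invmx (ctr J *m J) *m ctr F in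
  I_LB H Es N0 F (ctr J *m J) =
  (Nt%:R * ln Es + logdet (ctr J *m J) + Nt%:R
   + (2 * Es * complex.Re (\tr (ctr H *m F)) - Es * complex.Re (\tr (ctr J *m J)))
   - (Es * complex.Re (\tr (ctr H *m E *m H)) + N0 * complex.Re (\tr E)))%:E.
Proof.
move=> J0 E; rewrite /I_LB Exy_ln_pm_cond.
(* The form given by [E] at [y = H *m x + z], pulled back to the stacked vector of [x] and [z]. *)
pose M := block_mx (ctr H *m E *m H) (ctr H *m E) (E *m H) E.
rewrite (@Exy_quad _ (- (Nt%:R * ln Es + logdet (ctr J *m J))) M) => [|x z].
  rewrite /M block_mxKul block_mxKdr -EFinB; congr EFin; ring.
rewrite elog_pm_marg // -/E; clearbody E; congr (_ + complex.Re _)%:E.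
set y := H *m x + z.
have -> : M *m col_mx x z = col_mx (ctr H *m (E *m y)) (E *m y).
  by rewrite /M mul_block_col /y !mulmxDr !mulmxA.
by rewrite ip_col [in RHS]ip_mulr ctrK -ipDl.
Qed.

End Model.
End Expectation.

(** * Optimization over the front-end filter *)

Section Optimization.
Variables (R : realType) (Nr n : nat).
Local Notation C := R[i].
Variables (H : 'M[C]_(Nr, n)) (Es N0 : R) (Qa : 'M[C]_(Nr + n, n)) (La : 'M[C]_n).
Hypotheses (Es0 : 0 < Es) (N00 : 0 < N0) (QaE : ctr Qa *m Qa = 1%:M).
Hypotheses (LaU : La \in unitmx) (HaE : H_aug H Es N0 = Qa *m La).

Local Notation W := (W_MMSE H Es N0).
(** Covariance of the observation [y]. *)
Let K : 'M[C]_Nr := Es%:C%C *: (H *m ctr H) + (N0%:C%C)%:M.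
Let Omega : 'M[C]_n := ctr H *m H + ((N0 / Es)%:C)%C%:M.

(** [Omega] is [N0] times the Gram matrix of [H_aug], in which [Qa] cancels because its columns are
    orthonormal. *)
Lemma Omega_La : Omega = N0%:C%C *: (ctr La *m La).
Proof.
have -> : ctr La *m La = ctr (H_aug H Es N0) *m H_aug H Es N0.
  by rewrite HaE ctrM mulmxA -[_ *m _ *m Qa]mulmxA QaE mulmx1.
have sq (x : R) : 0 < x -> (Num.sqrt x)^-1 * (Num.sqrt x)^-1 = x^-1.
  by move=> x0; rewrite -invfM -expr2 sqr_sqrtr // ltW.
rewrite /H_aug ctr_col_mx mul_row_col !ctrZ !conjc_real ctr1.
rewrite -!scalemxAl -!scalemxAr mulmx1 !scalerA -!rmorphM !sq //.
rewrite scalerDr !scalerA -!rmorphM divff ?gt_eqF // scale1r.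
by rewrite scalemx1.
Qed.

Lemma Omega_unit : Omega \in unitmx.
Proof.
rewrite Omega_La unitmxZ ?unitmx_mul ?ctr_unit ?LaU //.
by rewrite unitfE (fmorph_eq0 (real_complex R)) gt_eqF.
Qed.

(** The left-hand side is the MMSE error covariance. *)
Lemma Omega_inv :
  N0%:C%C *: invmx Omega = invmx La *m ctr (invmx La).
Proof.
have E : Omega *m (invmx La *m ctr (invmx La)) = N0%:C%C%:M.
  rewrite Omega_La -scalemxAl mulmxA mulmxK // ctr_inv mulmxV ?ctr_unit //.
  by rewrite scalemx1.
by rewrite -[RHS](mulKmx Omega_unit) E mul_mx_scalar.
Qed.

Lemma ctr_Omega : ctr Omega = Omega.
Proof. by rewrite /Omega ctrD ctrM ctrK ctr_scalar conjc_real. Qed.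

Lemma ctr_K : ctr K = K.
Proof. by rewrite /K ctrD ctrZ ctrM ctrK ctr_scalar !conjc_real. Qed.

(** Orthogonality principle: the right-hand side is the cross-covariance of [x] and [y]. It follows
    from [Omega *m (Es *: ctr H) = ctr H *m K]. *)
Lemma W_MMSE_K : W *m K = Es%:C%C *: ctr H.
Proof.
have E : Omega *m (Es%:C%C *: ctr H) = ctr H *m K.
  rewrite /K mulmxDr mul_mx_scalar -!scalemxAr /Omega mulmxDl scalerDr -mulmxA.
  congr (_ + _); rewrite mul_scalar_mx scalerA -rmorphM mulrC divfK //.
  by rewrite gt_eqF.
by rewrite /W_MMSE -mulmxA -E mulKmx // Omega_unit.
Qed.

Lemma ctr_H_W : ctr H *m ctr W = 1%:M - ((N0 / Es)%:C)%C *: invmx Omega.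
Proof.
rewrite /W_MMSE -/Omega ctrM ctrK ctr_inv ctr_Omega mulmxA.
rewrite -[ctr H *m H](addrK ((N0 / Es)%:C)%C%:M) -/Omega mulmxBl.
by rewrite mulmxV ?Omega_unit // mul_scalar_mx.
Qed.

Lemma tr_mul_K (A : 'M[C]_Nr) : complex.Re (\tr (A *m K))
  = Es * complex.Re (\tr (ctr H *m A *m H)) + N0 * complex.Re (\tr A).
Proof.
rewrite /K mulmxDr mul_mx_scalar -scalemxAr mxtraceD !mxtraceZ ReD !ReZ.
by rewrite mulmxA mxtrace_mulC mulmxA.
Qed.

(** Expanding around [ctr W *m G], the terms linear in the deviation cancel by [W_MMSE_K]. The
    deviation is multiplied by [invmx J] so that its quadratic term becomes a sum of Frobenius
    norms. *)
Lemma complete_square (F : 'M[C]_(Nr, n)) (J : 'M[C]_n) : J \in unitmx ->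
  let G := ctr J *m J in
  let E := F *m invmx G *m ctr F in
  let L := (F - ctr W *m G) *m invmx J in
  (2 * Es * complex.Re (\tr (ctr H *m F)) - Es * complex.Re (\tr G))
   - (Es * complex.Re (\tr (ctr H *m E *m H)) + N0 * complex.Re (\tr E))
  = - fro (J *m invmx La) - (Es * fro (ctr L *m H) + N0 * fro (ctr L)).
Proof.
move=> uJ G E L; set D := F - ctr W *m G.
have uG : G \in unitmx by rewrite unitmx_mul ctr_unit uJ.
have GH : ctr G = G by rewrite ctrM ctrK.
have FE : F = D + ctr W *m G by rewrite subrK.
have EE : E = L *m ctr L + D *m W + ctr W *m ctr D + ctr W *m G *m W.
  have -> : L *m ctr L = D *m invmx G *m ctr D.
    rewrite /L -/D ctrM !mulmxA; congr (_ *m _); rewrite -!mulmxA; congr (_ *m _).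
    apply: (can_inj (mulKmx uG)); rewrite mulmxV // /G -mulmxA mulKVmx //.
    by rewrite ctr_inv mulmxV // ctr_unit.
  rewrite /E; clearbody D G; rewrite {1 2}FE ctrD ctrM ctrK GH mulmxDr !mulmxDl -!mulmxA.
  by rewrite !(mulKmx uG) !(mulKVmx uG) addrACA addrA.
have TDW : complex.Re (\tr (D *m W *m K)) = Es * complex.Re (\tr (ctr H *m D)).
  by rewrite -mulmxA W_MMSE_K -scalemxAr mxtraceZ ReZ mxtrace_mulC.
have TWD : complex.Re (\tr (ctr W *m ctr D *m K)) = Es * complex.Re (\tr (ctr H *m D)).
  rewrite -TDW; transitivity (complex.Re ((\tr (D *m W *m K))^*%C)); last exact: Re_conjc.
  by rewrite -mxtrace_ctr !ctrM ctr_K [in LHS]mxtrace_mulC.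
have TWG : complex.Re (\tr (ctr W *m G *m W *m K))
    = Es * complex.Re (\tr (ctr H *m ctr W *m G)).
  by rewrite -[_ *m W *m K]mulmxA W_MMSE_K -scalemxAr mxtraceZ ReZ mxtrace_mulC mulmxA.
(* The remaining constant is the trace of [G] against the error covariance, which [Omega_inv] turns
   into a Frobenius norm. *)
have THG : Es * complex.Re (\tr (ctr H *m ctr W *m G))
    = Es * complex.Re (\tr G) - fro (J *m invmx La).
  rewrite ctr_H_W mulmxBl mul1mx linearB /= ReB mulrBr; congr (_ - _).
  rewrite -ReZ -mxtraceZ scalemxAl scalerA -rmorphM mulrC divfK ?gt_eqF //.
  by rewrite Omega_inv /fro ctrM -(mulmxA (invmx La)) [in LHS]mxtrace_mulC /G !mulmxA.
clearbody E L D G; rewrite -tr_mul_K EE !mulmxDl !mxtraceD !ReD TDW TWD TWG THG.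
rewrite {1}FE mulmxDr mxtraceD ReD mulmxA mulrDr -[_ * _ * _ (\tr (_ *m G))]mulrA THG.
rewrite tr_mul_K /fro (ctrM (ctr L) H) !(ctrK L) !mulmxA; ring.
Qed.

End Optimization.

(** * The optimal filter pair and the optimal rate *)

Unset Implicit Arguments.
Set Strict Implicit.

(* N_t = nu + k with 1 <= nu and 1 <= k (i.e. 1 <= nu <= N_t - 1, N_t >= 2) *)
Theorem theorem3 (R : realType) (Nr nu k : nat)
  (H : 'M[R[i]]_(Nr, nu + k)) (Es N0 : R)
  (Qa : 'M[R[i]]_(Nr + (nu + k), nu + k)) (La : 'M[R[i]]_(nu + k)) :
  (1 <= nu)%N -> (1 <= k)%N -> (nu + k <= Nr)%N ->
  0 < Es -> 0 < N0 ->
  ctr Qa *m Qa = 1%:M -> lower_tri_posdiag La ->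
  H_aug H Es N0 = Qa *m La ->
  let Gopt := ctr (L_ap La) *m L_ap La in
  let Fopt := ctr (W_MMSE H Es N0) *m Gopt in
  [/\ punctured (L_ap La),
      (forall (F : 'M[R[i]]_(Nr, nu + k)) (J : 'M[R[i]]_(nu + k)),
          punctured J -> (I_LB H Es N0 F (ctr J *m J) <= I_LB H Es N0 Fopt Gopt)%E) &
      I_LB H Es N0 Fopt Gopt = ((nu + k)%:R * ln Es + logdet Gopt)%:E].
Proof.
move=> _ _ _ Es0 N00 QaE La_tri HaE Gopt Fopt.
have uLa := La_unit La_tri; have dL := det_L_ap_neq0 La_tri.
(* For invertible [J], the filter [F] enters only through a nonnegative penalty that vanishes at
   [F = ctr W *m G]. *)
have val F (J : 'M[R[i]]_(nu + k)) (J0 : \det J != 0) :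
    I_LB H Es N0 F (ctr J *m J) = ((nu + k)%:R * ln Es
      + (logdet (ctr J *m J) - fro (J *m invmx La)) + (nu + k)%:R
      - (Es * fro (ctr ((F - ctr (W_MMSE H Es N0) *m (ctr J *m J)) *m invmx J) *m H)
         + N0 * fro (ctr ((F - ctr (W_MMSE H Es N0) *m (ctr J *m J)) *m invmx J))))%:E.
  have uJ : J \in unitmx by rewrite unitmxE unitfE.
  rewrite I_LB_regular // -addrA (complete_square Es0 N00 QaE uLa HaE F uJ).
  by congr EFin; ring.
(* The penalty is 0 and, by [fro_L_ap], the Frobenius term cancels the added dimension. *)
have opt : I_LB H Es N0 Fopt Gopt = ((nu + k)%:R * ln Es + logdet Gopt)%:E.
  rewrite val // subrr mul0mx ctr0 mul0mx !fro0 (fro_L_ap La_tri).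
  by congr EFin; rewrite -/Gopt; ring.
split; [exact: punctured_L_ap| |exact: opt].
move=> F J pJ; have [J0|J0] := eqVneq (\det J) 0.
  by rewrite I_LB_singular // leNye.
rewrite opt val // lee_fin.
have := punctured_logdet_le La_tri pJ J0; rewrite -/Gopt.
set X := ctr (_ *m invmx J).
have : 0 <= Es * fro (X *m H) + N0 * fro X.
  by rewrite addr_ge0 // mulr_ge0 ?fro_ge0 // ltW.
move: (_ + N0 * fro X) (logdet (ctr J *m J)) (logdet Gopt) (fro (J *m _)).
by move=> a b u w; lra.
Qed.
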